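(* Suppose $X$ is a Cantor set and $\mathcal{G}\subset\mathrm{Homeo}(X)$ is an ample group that acts minimally on $X$. Then there are uncountably many infinite, nowhere dense closed sets $Y\subset X$ such that the stabilizer $\mathrm{St}_{\mathcal{G}}(Y)$ acts minimally when restricted to $Y$.
   Context: $\mathrm{Homeo}(X)$ is the group of all homeomorphisms of $X$. For a group $G\subset\mathrm{Homeo}(X)$, its full amplification $\mathsf{F}(G)$ is the group of all homeomorphisms $f$ of $X$ such that every point $x\in X$ has an open neighborhood $U_x$ on which $f$ coincides with some element of $G$. The group $G$ is called ample if $\mathsf{F}(G)=G$. A group acting by homeomorphisms on a space acts minimally if the only closed invariant subsets are the empty set and the whole space. $\mathrm{St}_{\mathcal{G}}(Y)=\{g\in\mathcal{G}\mid g(Y)=Y\}$. *)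

(* Defs.v *)
From mathcomp Require Import all_boot.
From mathcomp Require Import boolp classical_sets functions cardinality topology.
From mathcomp Require Import cantor.

Set Implicit Arguments.
Unset Strict Implicit.
Unset Printing Implicit Defensive.

Local Open Scope classical_set_scope.

Definition homeomorphism (X Y : topologicalType) (f : X -> Y) : Prop :=
  continuous f /\
  exists g : Y -> X, [/\ cancel f g, cancel g f & continuous g].

(* The library's [cantor_like] is not used: it does not imply metrizability,
   and it holds for the empty space. *)
Definition cantor_set (X : topologicalType) : Prop :=
  exists f : cantor_space -> X, homeomorphism f.

Definition homeo_group (X : topologicalType) (G : set (X -> X)) : Prop :=
  [/\ forall f, G f -> homeomorphism f,
      G idfun,
      forall f g, G f -> G g -> G (f \o g) &
      forall f g, G f -> cancel f g -> cancel g f -> G g].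

Definition full_amplification (X : topologicalType) (G : set (X -> X)) :
    set (X -> X) :=
  [set f | homeomorphism f /\
    forall x, exists U : set X, [/\ open U, U x &
      exists2 g, G g & forall y, U y -> f y = g y]].

Definition ample (X : topologicalType) (G : set (X -> X)) : Prop :=
  full_amplification G = G.

Definition invariant (X : Type) (G : set (X -> X)) (Z : set X) : Prop :=
  forall g, G g -> g @` Z = Z.

Definition stabilizer (X : Type) (G : set (X -> X)) (Y : set X) :
    set (X -> X) :=
  [set g | G g /\ g @` Y = Y].

Definition acts_minimally (X : topologicalType) (G : set (X -> X)) : Prop :=
  forall Z : set X, closed Z -> invariant G Z -> Z = set0 \/ Z = setT.

(* Minimality of the action restricted to [Y], where [Y] carries the relative
   topology.  The carrier of the library's [subspace Y] is all of [X], hence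
   the explicit condition [Z `<=` Y]. *)
Definition acts_minimally_on (X : topologicalType) (H : set (X -> X))
    (Y : set X) : Prop :=
  forall Z : set X, Z `<=` Y -> closed (Z : set (subspace Y)) ->
    invariant H Z -> Z = set0 \/ Z = Y.

Definition nowhere_dense (X : topologicalType) (Y : set X) : Prop :=
  interior (closure Y) = set0.

(* Main.v *)
(** Every point [x] of [X] lies on a set [Y] of the required kind; since the
    sets [Y] are closed and nowhere dense, the Baire property then rules out
    that there are only countably many of them.

    Given [x], minimality provides [k_n] in [G] and clopen neighborhoods [V_n]
    shrinking to [x] such that [V_{n+1}] and [k_n V_{n+1}] are disjoint subsets
    of [V_n] that do not cover it.  The translates of [V_n] by the [2^n]
    products [g = k_0^{e_0} ... k_{n-1}^{e_{n-1}}], [e_i] in [{0, 1}], are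
    disjoint.  Let [Y] be the closure of the set of all points [g x].  It misses
    a point of each [V_n], hence is nowhere dense.  The involution that
    exchanges [V_n] and [g V_n] by means of [g] and is the identity elsewhere
    belongs to [G] by ampleness, and preserves [Y].  As [Y] is covered by the
    [g V_n], these involutions bring any point of [Y] arbitrarily close to [x],
    and [x] to every [g x]: the stabilizer of [Y] is minimal on [Y]. *)

Require Import Defs.
From mathcomp Require Import all_boot.
From mathcomp Require Import boolp classical_sets functions cardinality topology.
From mathcomp Require Import cantor.

Local Open Scope classical_set_scope.

(** * Auxiliary facts on closed sets, continuity and compactness *)

Lemma nested_homo T (D : nat -> set T) :
  (forall n, D n.+1 `<=` D n) -> forall m n, (m <= n)%N -> D n `<=` D m.
Proof.
move=> DS m n; apply: (@homo_leq _ D (fun A B => B `<=` A)); last exact: DS.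
  exact: subset_refl.
by move=> B A C AB BC; exact: subset_trans BC AB.
Qed.

Lemma closed_homeomorphism_image (X Y : topologicalType) (f : X -> Y)
    (A : set X) :
  homeomorphism f -> closed A -> closed (f @` A).
Proof.
move=> [_ [g [fK gK cg]]] cA.
suff -> : f @` A = g @^-1` A by move/continuous_closedP: cg; apply.
by apply/seteqP; split=> [_ [a Aa <-]|y Agy] /=; [rewrite fK|exists (g y)].
Qed.

Lemma continuous_image_closure (S T : topologicalType) (f : S -> T)
    (A : set S) :
  continuous f -> f @` closure A `<=` closure (f @` A).
Proof.
move=> cf _ [p clp <-] B /cf /clp[q [Aq Bq]].
by exists (f q); split=> //; exists q.
Qed.

Lemma locally_equal_continuous (S T : topologicalType) (h : S -> T) :
  (forall x, exists U : set S, [/\ open U, U x &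
     exists2 g : S -> T, continuous g & forall y, U y -> h y = g y]) ->
  continuous h.
Proof.
move=> hloc x B /=; have [U [oU Ux [g cg hg]]] := hloc x.
rewrite hg// => /(cg x) gB; rewrite /nbhs/=.
have : nbhs x (U `&` g @^-1` B).
  by apply: filterI => //; exact: open_nbhs_nbhs.
by apply: filterS => y [Uy /=]; rewrite hg.
Qed.

(** A sequence with one point chosen in each set eventually stays in every [D n], so its cluster
    point lies in all of them. *)
Lemma compact_nested_closed (X : topologicalType) (D : nat -> set X) :
  compact [set: X] -> (forall n, closed (D n)) -> (forall n, D n !=set0) ->
  (forall n, D n.+1 `<=` D n) -> exists p, forall n, D n p.
Proof.
move=> cX cD D0 DS; have [s sD] := choice D0.
have [|p [_ clp]] := cX (s @ \oo) _; first exact: filterT.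
exists p => n; apply: cD => B pB.
by apply: clp => //; exists n => // i /= ni; exact: nested_homo (sD i).
Qed.

(** * The set [closure (tail 0)] attached to given sequences [V] and [k] *)

Section tail_orbit.
Variables (X : topologicalType) (G : set (X -> X)).
Hypotheses (groupG : homeo_group G) (ampleG : ample G).
Variables (x : X) (V : nat -> set X) (k : nat -> X -> X) (z : nat -> X).
Hypotheses (openV : forall n, open (V n)) (closedV : forall n, closed (V n)).
Hypotheses (Vx : forall n, V n x) (VS : forall n, V n.+1 `<=` V n).
Hypothesis basisV : forall U : set X, open U -> U x -> exists n, V n `<=` U.
Hypotheses (Gk : forall n, G (k n)) (kV : forall n, k n @` V n.+1 `<=` V n).
Hypothesis kNV : forall n v, V n.+1 v -> ~ V n.+1 (k n v).
Hypotheses (Vz : forall n, V n (z n)) (zNV : forall n, ~ V n.+1 (z n)).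
Hypothesis zNkV : forall n, ~ (k n @` V n.+1) (z n).

Let Ghomeo f : G f -> homeomorphism f.
Proof. by case: groupG => + _ _ _; exact. Qed.

Let G1 : G idfun. Proof. by case: groupG. Qed.

Let GM f g : G f -> G g -> G (f \o g).
Proof. by case: groupG => _ _ + _; exact. Qed.

Let GV f g : G f -> cancel f g -> cancel g f -> G g.
Proof. by case: groupG => _ _ _; exact. Qed.

Let inv g : G g -> exists g', [/\ cancel g g', cancel g' g & G g'].
Proof.
move=> Gg; have [_ [g' [gK g'K _]]] := Ghomeo _ Gg.
by exists g'; split=> //; exact: GV Gg _ _.
Qed.

Let Ginj g : G g -> injective g.
Proof. by move=> /inv[g' [/can_inj]]. Qed.

(* [tail n] consists of the points [k n ^ e_n (k n.+1 ^ e_n.+1 (... x))] with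
   finitely many nonzero exponents [e_i] in [{0, 1}]. *)
Inductive tail : nat -> X -> Prop :=
| tail_base n : tail n x
| tail_stay n y of tail n.+1 y : tail n y
| tail_move n y of tail n.+1 y : tail n (k n y).

(** The products [k 0 ^ e_0 ... k (n - 1) ^ e_(n - 1)] with exponents 0 or 1. A new letter is
    composed on the right, so it acts first. *)
Fixpoint words n : set (X -> X) :=
  if n is n'.+1 then words n' `|` [set g \o k n' | g in words n']
  else [set idfun].

Lemma words_group n : words n `<=` G.
Proof.
by elim: n => [|n IH] g /= => [->//|[/IH//|[h /IH Gh <-]]]; exact: GM.
Qed.

Lemma words_id n : words n idfun.
Proof. by elim: n => //= n IH; left. Qed.

Lemma tail_sub n y : tail n y -> V n y.
Proof.
elim=> {n y} [n|n y _ /VS//|n y _ Vy]; first exact: Vx.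
by apply: kV; exists y.
Qed.

Lemma tailS n y : tail n y ->
  tail n.+1 y \/ exists2 y', tail n.+1 y' & y = k n y'.
Proof.
move=> ty; inversion ty; subst; first by left; exact: tail_base.
  by left.
by right; exists y0.
Qed.

(** The first [n] exponents form the word, the others the tail; [tailS] hands one more exponent from
    the tail to the word. *)
Lemma tail0P n y : tail 0 y <-> exists g t, [/\ words n g, tail n t & y = g t].
Proof.
elim: n y => [|n IH] y.
  split=> [ty|[g [t [/= -> tt ->]]]//]; by exists idfun, y.
rewrite IH; split=> [[g [t [wg + ->]]]|[g [t [/= + tt ->]]]].
  move=> /tailS[tt|[t' tt' ->]].
    by exists g, t; split=> //; left.
  by exists (g \o k n), t'; split=> //; right; exists g.
move=> [wg|[h wh <-]]; first by exists g, t; split=> //; exact: tail_stay.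
by exists h, (k n t); split=> //; exact: tail_move.
Qed.

Lemma tail_sub0 n y : tail n y -> tail 0 y.
Proof.
by move=> ty; apply/(tail0P n); exists idfun, y; split=> //; exact: words_id.
Qed.

Lemma tail0_word y : tail 0 y -> exists n g, words n g /\ y = g x.
Proof.
(* Generalized for the induction: [g] accumulates the letters already read off the derivation of
   [tail]. *)
suff H n t : tail n t -> forall g, words n g ->
    exists m h, words m h /\ g t = h x.
  by move=> ty; exact: (H 0 y ty idfun (words_id 0)).
elim=> {n t} [n g wg|n t _ IH g wg|n t _ IH g wg].
- by exists n, g.
- by apply: IH; left.
- by apply: (IH (g \o k n)); right; exists g.
Qed.

(** Since [k n] maps [V n.+1] into [V n], the induction hypothesis identifies the words stripped of
    a last [k n]. If only one of them had this letter, injectivity would put a point of [V n.+1] and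
    its image under [k n] both in [V n.+1], against [kNV]. *)
Lemma words_disjoint n g g' v v' : words n g -> words n g' ->
  V n v -> V n v' -> g v = g' v' -> g = g'.
Proof.
elim: n g g' v v' => [|n IH] g g' v v' /=; first by move=> -> ->.
move=> [wg|[h wh <-]] [wg'|[h' wh' <-]] Vv Vv' /= e.
- by apply: IH e => //; exact: VS.
- have kv' : V n (k n v') by apply: kV; exists v'.
  have gh : g = h' by apply: IH e => //; exact: VS.
  move: e; rewrite gh => /(Ginj _ (words_group _ _ wh')) vk.
  by have := kNV _ _ Vv'; rewrite -vk.
- have kv : V n (k n v) by apply: kV; exists v.
  have gh : h = g' by apply: IH e => //; exact: VS.
  move: e; rewrite gh => /(Ginj _ (words_group _ _ wg')) vk.
  by have := kNV _ _ Vv; rewrite vk.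
- suff -> : h = h' by [].
  by apply: IH e => //; apply: kV; [exists v|exists v'].
Qed.

(** The word of [y] sends a point of [V n] into [V n], so disjointness makes it trivial. *)
Lemma tail0_inV n y : tail 0 y -> V n y -> tail n y.
Proof.
move=> /(tail0P n)[g [t [wg tt yE]]] Vy.
suff g1 : g = idfun by rewrite yE g1.
by apply: (words_disjoint n _ _ t y) => //; [exact: words_id|exact: tail_sub].
Qed.

(** The induction absorbs the last letter into [A]. With [A = V n], this keeps the closure of
    [tail 0] within the translates of [V n]. *)
Lemma closed_words_image n (A : set X) : closed A ->
  closed [set y | exists g a, [/\ words n g, A a & y = g a]].
Proof.
elim: n A => [|n IH] A cA.
  suff -> : [set y | exists g a, [/\ words 0 g, A a & y = g a]] = A by [].
  apply/seteqP; split=> [_ [g [a [/= -> Aa ->]]]//|y Ay].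
  by exists idfun, y.
have -> : [set y | exists g a, [/\ words n.+1 g, A a & y = g a]] =
    [set y | exists g a, [/\ words n g, (A `|` k n @` A) a & y = g a]].
  apply/seteqP; split=> y [g [a []]].
    move=> /= [wg|[h wh <-]] Aa ->; first by exists g, a; split=> //; left.
    by exists h, (k n a); split=> //; right; exists a.
  move=> wg [Aa|[b Ab <-]] ->; first by exists g, a; split=> //; left.
  by exists (g \o k n), b; split=> //; right; exists g.
apply/IH/closedU => //.
by apply: closed_homeomorphism_image => //; exact: Ghomeo.
Qed.

(* [h] exchanges [V n] and [g @` V n]; it is the identity if [g] is, and the two
   sets are disjoint otherwise. *)
Lemma tail_swap n g : words n g -> exists h : X -> X,
  [/\ stabilizer G (closure (tail 0)) h, h x = g x, involutive h &
      forall v, V n v -> h (g v) = v].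
Proof.
move=> wg; have Gg := words_group _ _ wg; have [g' [gK g'K Gg']] := inv _ Gg.
have /continuousP open_g' : continuous g' by have [] := Ghomeo _ Gg'.
pose h y := if pselect (V n y) then g y
            else if pselect (V n (g' y)) then g' y else y.
have hV y : V n y -> h y = g y by rewrite /h; case: pselect.
have hV' y : ~ V n y -> V n (g' y) -> h y = g' y.
  by rewrite /h; case: pselect => //= nVy; case: pselect.
have hN y : ~ V n y -> ~ V n (g' y) -> h y = y.
  by rewrite /h; case: pselect => //= nVy; case: pselect.
have hg v : V n v -> h (g v) = v.
  move=> Vv; case: (pselect (V n (g v))) => Vgv; last by rewrite hV' ?gK.
  (* Here [V n] meets its translate by [g], which leaves only the identity. *)
  suff g1 : g = idfun by rewrite hV// g1.
  by apply: (words_disjoint n _ _ v (g v)) => //; exact: words_id.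
have hh : involutive h.
  move=> y; case: (pselect (V n y)) => Vy; first by rewrite (hV y)// hg.
  case: (pselect (V n (g' y))) => Vg'y; first by rewrite (hV' y)// hV// g'K.
  by rewrite (hN y)// hN.
have hloc y : exists U : set X, [/\ open U, U y &
    exists2 f, G f & forall y, U y -> h y = f y].
  case: (pselect (V n y)) => Vy; first by exists (V n); split=> //; exists g.
  have oNV : open (~` V n) by exact: closed_openC.
  case: (pselect (V n (g' y))) => Vg'y.
    exists (~` V n `&` g' @^-1` V n); split=> //; last first.
      by exists g' => // ? [? ?]; exact: hV'.
    by apply: openI => //; exact: open_g'.
  exists (~` V n `&` g' @^-1` (~` V n)); split=> //; last first.
    by exists idfun => // ? [? ?]; exact: hN.
  by apply: openI => //; exact: open_g'.
have ch : continuous h.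
  apply: locally_equal_continuous => y; have [U [oU Uy [f Gf fU]]] := hloc y.
  by exists U; split=> //; exists f => //; case: (Ghomeo _ Gf).
have Gh : G h.
  by rewrite -ampleG; split=> //; split=> //; exists h; split.
have htail : h @` tail 0 `<=` tail 0.
  move=> _ [y ty <-]; have [g1 [t [wg1 tt yE]]] := (tail0P n y).1 ty.
  case: (pselect (V n y)) => Vy.
    rewrite hV//; apply/(tail0P n); exists g, y.
    by split=> //; exact: tail0_inV.
  case: (pselect (V n (g' y))) => Vg'y; last by rewrite hN.
  (* The point [y] lies in the translates of [V n] by [g1] and by [g], so these words agree. *)
  suff tE : t = g' y by rewrite hV'// -tE; exact: tail_sub0 tt.
  suff gE : g1 = g by rewrite yE gE gK.
  apply: (words_disjoint n _ _ t (g' y)) => //; first exact: tail_sub.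
  by rewrite g'K.
have hcl : h @` closure (tail 0) `<=` closure (tail 0).
  apply: subset_trans (continuous_image_closure _ _ _ _ ch) _.
  exact: closureS.
exists h; split=> //; last exact: hV.
split=> //; apply/seteqP; split=> // y cy.
by exists (h y) => //; apply: hcl; exists y.
Qed.

Lemma tail_closure_minimal :
  acts_minimally_on (stabilizer G (closure (tail 0))) (closure (tail 0)).
Proof.
move=> Z ZY clZ invZ; have {}clZ : closed Z.
  have /closed_subspaceP[W cW WE] := clZ.
  have -> : Z = W `&` closure (tail 0) by rewrite WE; apply/esym/setIidPl.
  by apply: closedI => //; exact: closed_closure.
case: (pselect (Z !=set0)) => [[y Zy]|/set0P/negP/negPn/eqP ->]; last by left.
right; have invol h : stabilizer G (closure (tail 0)) h ->
    forall p, Z p -> Z (h p).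
  by move=> /invZ hZ p Zp; rewrite -hZ; exists p.
(* The point [y] lies in a translate of [V n] by some word; the swap for that word brings it into
   [V n], hence into [U], without leaving [Z]. *)
have Zx : Z x.
  apply: clZ => B; rewrite nbhsE => -[U [oU Ux] UB].
  have [n VU] := basisV _ oU Ux.
  have [g [v [wg Vv yE]]] : exists g v, [/\ words n g, V n v & y = g v].
    apply: (closed_words_image n (V n) (closedV n)).
    apply: closureS (ZY _ Zy) => t /(tail0P n)[g [v [wg tv ->]]].
    by exists g, v; split=> //; exact: tail_sub.
  have [h [sh _ _ hg]] := tail_swap _ _ wg.
  by exists v; split; [rewrite -(hg v)// -yE; exact: invol|exact/UB/VU].
apply/seteqP; split=> //.
have -> : Z = closure Z by apply/closure_id.
apply: closureS => _ /tail0_word[n [g [wg ->]]].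
by have [h [sh <- _ _]] := tail_swap _ _ wg; exact: invol.
Qed.

(** A point of [tail 0] in [V n] is in [tail n], hence in [V n.+1] or its image under [k n];
    removing these closed sets from [V n] leaves a neighborhood of [z n]. *)
Lemma z_notin_closure n : ~ closure (tail 0) (z n).
Proof.
pose W := V n.+1 `|` k n @` V n.+1.
have cW : closed W.
  apply: closedU => //.
  by apply: closed_homeomorphism_image => //; exact: Ghomeo.
have : nbhs (z n) (V n `&` ~` W).
  apply: open_nbhs_nbhs; split.
    by apply: openI => //; exact: closed_openC.
  by split=> //; case; [exact: zNV|exact: zNkV].
move=> nz /(_ _ nz)[y [ty [Vy]]]; apply.
have /tailS[/tail_sub ?|[y' /tail_sub Vy' ->]] := tail0_inV _ _ ty Vy.
  by left.
by right; exists y'.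
Qed.

(** Some interior point would have the form [g x]. The swap for [g] preserves the closure, which
    would then contain a neighborhood of [x], hence some [V m] and its point [z m]. *)
Lemma tail_closure_nowhere_dense : nowhere_dense (closure (tail 0)).
Proof.
rewrite /nowhere_dense.
have <- := (closure_id _).1 (@closed_closure _ (tail 0)).
apply/eqP/negPn/negP => /set0P[y iy].
have [p [/tail0_word[n [g [wg pE]]] ip]] :=
  interior_subset iy _ (nbhs_interior iy).
have [h [[Gh hY] hx hh _]] := tail_swap _ _ wg.
have /continuousP open_h : continuous h by have [] := Ghomeo _ Gh.
have [||m Vm] := basisV (h @^-1` (closure (tail 0))°).
- by apply: open_h; exact: open_interior.
- by rewrite /= hx -pE.
apply: (z_notin_closure m); have /interior_subset := Vm _ (Vz m).
by rewrite -{1}hY => -[q cq] /(inv_inj hh) <-.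
Qed.

(** The points [k n x] are distinct: for [m < n], [V m.+1] contains [k n x] but not [k m x]. *)
Lemma tail_closure_infinite : infinite_set (closure (tail 0)).
Proof.
suff : infinite_set (tail 0).
  by apply: contra_not; apply: sub_finite_set; exact: subset_closure.
have kx n : V n (k n x) by apply: kV; exists x.
have lt_neq m n : (m < n)%N -> k m x <> k n x.
  move=> mn e; apply: (kNV m x) => //; rewrite e.
  exact: nested_homo mn _ (kx n).
have cardr : (range (fun n => k n x) #= [set: nat])%card.
  apply: inj_card_eq => m n _ _ e.
  by case: (ltngtP m n) => // /lt_neq; rewrite e.
apply/infiniteP; rewrite -(card_le_eql cardr); apply: subset_card_le.
move=> _ [n _ <-]; apply: (tail_sub0 n); apply: tail_move; exact: tail_base.
Qed.

End tail_orbit.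

(** * Cylinders in binary coordinates: the choice of [V] and [k], and the Baire argument *)

Section cylinder.
Variables (X : topologicalType).
Variables (phi : X -> nat -> bool) (psi : (nat -> bool) -> X).
Hypotheses (phiK : cancel phi psi) (psiK : cancel psi phi).
Hypothesis open_digit : forall i b, open [set y | phi y i = b].
Hypothesis compactX : compact [set: X].

Definition cylinder n x : set X :=
  [set y | forall i, (i < n)%N -> phi y i = phi x i].

Lemma cylinder_refl n x : cylinder n x x. Proof. by []. Qed.

Lemma cylinder_eq n x y : cylinder n x y -> cylinder n y = cylinder n x.
Proof.
move=> xy; apply/seteqP; split=> w yw i ilt; first by rewrite yw// xy.
by rewrite yw// xy.
Qed.

Lemma cylinder_mono m n x : (m <= n)%N -> cylinder n x `<=` cylinder m x.
Proof. by move=> mn y ny i im; apply: ny; exact: leq_trans mn. Qed.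

Lemma cylinderS n x :
  cylinder n.+1 x = cylinder n x `&` [set y | phi y n = phi x n].
Proof.
apply/seteqP; split=> y /=.
  by move=> ny; split=> [i ilt|]; apply: ny => //; exact: ltnW.
by move=> [ny nE] i; rewrite ltnS leq_eqVlt => /predU1P[->//|/ny].
Qed.

Lemma cylinder_open n x : open (cylinder n x).
Proof.
elim: n => [|n IH]; last by rewrite cylinderS; exact: openI.
have -> : cylinder 0 x = setT by apply/seteqP; split=> // y _ i.
exact: openT.
Qed.

Lemma cylinder_closed n x : closed (cylinder n x).
Proof.
have digit i b : closed [set y | phi y i = b].
  suff -> : [set y | phi y i = b] = ~` [set y | phi y i = ~~ b].
    exact: open_closedC.
  by apply/seteqP; split=> y /=; case: b; case: (phi y i) => // /(_ erefl).
elim: n => [|n IH]; last by rewrite cylinderS; exact: closedI.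
have -> : cylinder 0 x = setT by apply/seteqP; split=> // y _ i.
exact: closedT.
Qed.

(** If no cylinder fitted into [U], compactness would give a point outside [U] common to all
    cylinders around [x]; its digits are those of [x]. *)
Lemma cylinder_basis x (U : set X) : open U -> U x ->
  exists n, cylinder n x `<=` U.
Proof.
move=> oU Ux; apply: contrapT => /forallNP nU.
have [n|n|n y [ny Uy]|p pD] :=
    @compact_nested_closed X (fun n => cylinder n x `&` ~` U) compactX.
- by apply: closedI; [exact: cylinder_closed|exact: open_closedC].
- by have /nonsubset := nU n.
- by split=> //; exact: cylinder_mono ny.
have [_ []] := pD 0%N; suff -> : p = x by [].
apply: (can_inj phiK); apply/funext => i.
by have [/(_ i (ltnSn i))] := pD i.+1.
Qed.

Definition flip n x : X :=
  psi (fun i => if i == n then ~~ phi x i else phi x i).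

Lemma flip_cylinder n x : cylinder n x (flip n x).
Proof. by move=> i ilt; rewrite /flip psiK ltn_eqF. Qed.

Lemma flip_neq n x y : cylinder n.+1 x y -> ~ cylinder n.+1 (flip n x) y.
Proof.
move=> /(_ n (ltnSn n)) yx /(_ n (ltnSn n)).
by rewrite yx /flip psiK eqxx; case: phi.
Qed.

(** One step in the choice of [V] and [k]. By minimality the orbit of [x] is dense, so some [g]
    sends [x] into [W], the half of [cylinder m x] that avoids [x]. *)
Lemma cylinder_split (G : set (X -> X)) x m :
  homeo_group G -> acts_minimally G ->
  exists nk : nat * (X -> X), [/\ (m < nk.1)%N, G nk.2,
    nk.2 @` cylinder nk.1 x `<=` cylinder m x,
    forall v, cylinder nk.1 x v -> ~ cylinder nk.1 x (nk.2 v) &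
    exists z, [/\ cylinder m x z, ~ cylinder nk.1 x z &
      ~ (nk.2 @` cylinder nk.1 x) z]].
Proof.
move=> [Ghomeo G1 GM GV] minG.
pose orb := [set g x | g in G].
have invorb g : G g -> g @` closure orb `<=` closure orb.
  move=> Gg; have [cg _] := Ghomeo _ Gg.
  apply: subset_trans (continuous_image_closure _ _ _ _ cg) _.
  by apply: closureS => _ [_ [f Gf <-] <-]; exists (g \o f) => //; exact: GM.
have [orb0|orbT] : closure orb = set0 \/ closure orb = setT.
- apply: minG; first exact: closed_closure.
  move=> g Gg; apply/seteqP; split; first exact: invorb.
  have [_ [g' [gK g'K _]]] := Ghomeo _ Gg.
  have Gg' := GV _ _ Gg gK g'K.
  by move=> y cy; exists (g' y) => //; apply: (invorb _ Gg'); exists y.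
- have : closure orb x by apply: subset_closure; exists idfun.
  by rewrite orb0.
pose W := cylinder m.+1 (flip m x).
have [_ [[g Gg <-] Wgx]] : orb `&` W !=set0.
  have : closure orb (flip m x) by rewrite orbT.
  apply; apply: open_nbhs_nbhs; split; first exact: cylinder_open.
  exact: cylinder_refl.
have [/continuousP open_g _] := Ghomeo _ Gg.
have [||n nW] := cylinder_basis x (g @^-1` W) => //.
  by apply: open_g; exact: cylinder_open.
have {}nW v : cylinder (maxn n m.+2) x v -> W (g v).
  by move=> /(cylinder_mono n _ x (leq_maxl _ _)) /nW.
have sub2 := cylinder_mono m.+2 _ x (leq_maxr n m.+2).
have WN v : W v -> ~ cylinder m.+1 x v by move=> Wv /flip_neq.
(* Depth at least [m.+2] leaves [flip m.+1 x] uncovered: it is outside the small cylinder, but still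
   in the half containing [x], hence outside [W]. *)
exists (maxn n m.+2, g); split=> //=.
- exact: leq_trans (leq_maxr n m.+2).
- move=> _ [v /nW Wv <-].
  rewrite -(cylinder_eq _ _ _ (flip_cylinder m x)).
  exact: cylinder_mono Wv.
- by move=> v /nW /WN + /sub2 /cylinder_mono H; apply; exact: H.
- exists (flip m.+1 x); split.
  + exact: cylinder_mono (flip_cylinder _ _).
  + by move=> /sub2 /flip_neq; apply; exact: cylinder_refl.
  + by move=> [v /nW /WN] + gv; rewrite gv; apply; exact: flip_cylinder.
Qed.

Lemma minimal_stabilizer_through (G : set (X -> X)) x :
  homeo_group G -> ample G -> acts_minimally G ->
  exists Y : set X, [/\ infinite_set Y, nowhere_dense Y, closed Y,
    acts_minimally_on (stabilizer G Y) Y & Y x].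
Proof.
move=> groupG ampleG minG.
have [step stepP] := choice (fun m => cylinder_split G x m groupG minG).
pose m n := iter n (fun i => (step i).1) 0%N.
pose V n := cylinder (m n) x; pose k n := (step (m n)).2.
have mlt n : (m n < m n.+1)%N by have [] := stepP (m n).
(* The depths are unbounded, so the [V n] form a neighborhood basis at [x]. *)
have mge n : (n <= m n)%N.
  by elim: n => // n IH; exact: leq_ltn_trans IH (mlt n).
have zP n : exists z, [/\ V n z, ~ V n.+1 z & ~ (k n @` V n.+1) z].
  by have [] := stepP (m n).
have [z {}zP] := choice zP.
have openV n : open (V n) by exact: cylinder_open.
have closedV n : closed (V n) by exact: cylinder_closed.
have Vx n : V n x by exact: cylinder_refl.
have VS n : V n.+1 `<=` V n by apply/cylinder_mono/ltnW.
have basisV (U : set X) : open U -> U x -> exists n, V n `<=` U.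
  move=> oU Ux; have [n nU] := cylinder_basis x U oU Ux.
  by exists n; apply: subset_trans nU; exact: cylinder_mono.
have Gk n : G (k n) by have [] := stepP (m n).
have kV n : k n @` V n.+1 `<=` V n by have [] := stepP (m n).
have kNV n v : V n.+1 v -> ~ V n.+1 (k n v).
  by have [_ _ _ + _] := stepP (m n); exact.
have Vz n : V n (z n) by have [] := zP n.
have zNV n : ~ V n.+1 (z n) by have [] := zP n.
have zNkV n : ~ (k n @` V n.+1) (z n) by have [] := zP n.
exists (closure (tail X x k 0)); split.
- exact: (tail_closure_infinite X x V k).
- exact: (tail_closure_nowhere_dense X G groupG ampleG x V k z).
- exact: closed_closure.
- exact: (tail_closure_minimal X G groupG ampleG x V k).
- by apply: subset_closure; exact: tail_base.
Qed.

(** Baire category by nested cylinders: [e] numbers the members of [S], and step [n] moves off the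
    set numbered [n], if there is one. *)
Lemma countable_nowhere_dense_avoid (S : set (set X)) :
  countable S -> (forall Y, S Y -> closed Y /\ nowhere_dense Y) ->
  exists x, forall Y, S Y -> ~ Y x.
Proof.
move=> /pcard_injP[e einj] SP.
have step (n : nat) (q : nat * X) : exists q' : nat * X,
    cylinder q'.1 q'.2 `<=` cylinder q.1 q.2 /\
    forall Y, S Y -> e Y = n -> cylinder q'.1 q'.2 `<=` ~` Y.
  case: (pselect (exists Y, S Y /\ e Y = n)) => [[Y [SY eY]]|nY]; last first.
    by exists q; split=> // Y SY eY; exfalso; apply: nY; exists Y.
  have [cY ndY] := SP Y SY.
  have [y [qy Yy]] : cylinder q.1 q.2 `&` ~` Y !=set0.
    apply/nonsubset => qY; have : interior (closure Y) q.2.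
      apply: (filterS (P := cylinder q.1 q.2)).
        by apply: subset_trans qY _; exact: subset_closure.
      apply: open_nbhs_nbhs; split; first exact: cylinder_open.
      exact: cylinder_refl.
    by rewrite ndY.
  have [||i iU] := cylinder_basis y (cylinder q.1 q.2 `&` ~` Y) => //.
    by apply: openI; [exact: cylinder_open|exact: closed_openC].
  exists (i, y); split=> [w /iU[]//|Y' SY' eY' w /iU[_ /=]].
  by suff -> : Y = Y' by []; apply: einj; rewrite ?inE ?eY ?eY'.
have [next nextP] := choice (fun nq => step nq.1 nq.2).
(* A pair is a depth and a center; depth 0 gives the whole space, so the first center is
   arbitrary. *)
pose q := fix q n :=
  if n is n'.+1 then next (n', q n') else (0%N, psi (fun=> true)).
have [n|n|n|p pD] :=
    @compact_nested_closed X (fun n => cylinder (q n).1 (q n).2) compactX.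
- exact: cylinder_closed.
- by exists (q n).2; exact: cylinder_refl.
- by have [] := nextP (n, q n).
(* The set numbered [n] is avoided from cylinder [n.+1] on. *)
exists p => Y SY; have [_ qP] := nextP (e Y, q (e Y)).
exact: qP SY erefl _ (pD (e Y).+1).
Qed.

End cylinder.

Theorem proposition7p2 (X : topologicalType) (G : set (X -> X)) :
  cantor_set X -> homeo_group G -> ample G -> acts_minimally G ->
  ~ countable [set Y : set X |
      [/\ infinite_set Y, nowhere_dense Y, closed Y &
          acts_minimally_on (stabilizer G Y) Y]].
Proof.
move=> [f [cf [g [fK gK cg]]]] groupG ampleG minG cS.
have compactX : compact [set: X].
  have -> : [set: X] = f @` [set: cantor_space].
    by apply/seteqP; split=> // y _; exists (g y).
  apply: continuous_compact cantor_space_compact.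
  exact: continuous_subspaceT.
have open_digit i b : open [set y | g y i = b].
  have /continuousP : continuous (mathcomp_extra.proj i \o g).
    by move=> y; apply: continuous_comp; [exact: cg|exact: proj_continuous].
  by move=> /(_ [set b] (discrete_open _)).
have [Y [_ ndY cY _]|x xN] :=
  countable_nowhere_dense_avoid X g f gK open_digit compactX _ cS.
  by split.
have [Y [iY ndY cY mY Yx]] :=
  minimal_stabilizer_through X g f gK fK open_digit compactX G x
    groupG ampleG minG.
by apply: (xN Y).
Qed.
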